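(* Let $P\in\mathbb C(z)$ be a non-constant rational function and $\gamma\subset\mathbb C$ a curve. (1) If the poles of $P$ lie on one side of $\gamma$, then for any rational function $q$ (with $P,q$ having no poles on $\gamma$) the function $I_\infty(t)=I_\infty(q,P,\gamma,t)$ is rational. (2) If the poles of $P$ and $q$ lie outside $\gamma$, then $I_\infty(t)\equiv0$.
   Context: A curve is an oriented piecewise-smooth curve in $\mathbb C$ (closed or not) having only transversal self-intersections; it is always assumed to contain no poles of $P$ or $q$, and $q\not\equiv0$. $U_\infty$ is the connected component of $\mathbb{CP}^1\setminus P(\gamma)$ containing $\infty$, and $I_\infty(q,P,\gamma,t)=\frac{1}{2\pi\sqrt{-1}}\int_\gamma\frac{q(z)\,dz}{P(z)-t}$ for $t\in U_\infty$. ''Rational'' means equal on $U_\infty$ to a rational function of $t$. Points $x_1,\dots,x_k\in\mathbb{CP}^1$ lie on one side of $\gamma$ if $\gamma$ is closed and homologous to zero in $\mathbb{CP}^1\setminus\{x_1,\dots,x_k\}$; equivalently, $\gamma$ is closed and the winding numbers $\mu(\gamma,x_1),\dots,\mu(\gamma,x_k)$ are all equal, where $\mu(\gamma,\infty)=0$. They lie outside $\gamma$ if $\gamma$ is closed and all these winding numbers are $0$. Poles are taken in $\mathbb{CP}^1$. *)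

(* Defs.v *)
From HB Require Import structures.
From mathcomp Require Import all_boot all_order all_algebra.
From mathcomp Require Import all_classical all_reals all_analysis.
From mathcomp Require Import complex.

Set Implicit Arguments.
Unset Strict Implicit.
Unset Printing Implicit Defensive.

Import Order.TTheory GRing.Theory Num.Theory.
Import numFieldNormedType.Exports.

Local Open Scope classical_set_scope.
Local Open Scope ring_scope.
Local Open Scope complex_scope.
Local Open Scope quotient_scope.

(* The library puts the topology of the norm on R[i]^o only. *)
HB.instance Definition _ (R : realType) :=
  PseudoPointedMetric.copy R[i] (R[i])^o.

(* The Riemann sphere: Some z is the finite point z, None is infinity. *)
Notation CP1 R := (one_point_compactification R[i]).

Section RationalFunctions.
Variable R : realType.

Definition ratfun : Type := {fraction {poly R[i]}}.

Implicit Types f : ratfun.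

(* f = rnum f / rden f in lowest terms; both are determined up to a common
   nonzero constant, which the values below do not depend on. *)
Definition rnum f : {poly R[i]} :=
  (repr f).1 %/ gcdp (repr f).1 (repr f).2.
Definition rden f : {poly R[i]} :=
  (repr f).2 %/ gcdp (repr f).1 (repr f).2.

(* The value of f at a finite point that is not a pole. *)
Definition rval f (z : R[i]) : R[i] := (rnum f).[z] / (rden f).[z].

(* f as a map from the Riemann sphere to itself. *)
Definition reval f (x : CP1 R) : CP1 R :=
  match x with
  | Some z => if root (rden f) z then None else Some (rval f z)
  | None => if (size (rden f) < size (rnum f))%N then None
            else Some ((rnum f)`_(size (rden f)).-1 / lead_coef (rden f))
  end.

Definition poles f : set (CP1 R) := [set x | reval f x = None].

Definition nonconstant f : Prop := forall c : R[i], f <> FracField.tofrac c%:P.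

(* F agrees on U with a rational function. *)
Definition rational_on (U : set (CP1 R)) (F : CP1 R -> R[i]) : Prop :=
  exists f : ratfun, forall t, U t -> reval f t = Some (F t).

End RationalFunctions.

Section Curves.
Variable R : realType.

Local Notation Re := (@complex.Re R).
Local Notation Im := (@complex.Im R).

Implicit Types g : R -> R[i].

(* g restricted to [c, d] is a regular C^1 arc: v is its derivative, extended
   continuously and without zeros to the end points. *)
Definition smooth_arc g (c d : R) : Prop :=
  exists v : R -> R[i],
    [/\ {within `[c, d], continuous v},
        forall s, s \in `[c, d] -> v s != 0 &
        forall s, s \in `]c, d[ ->
          is_derive s 1 (Re \o g) (Re (v s)) /\
          is_derive s 1 (Im \o g) (Im (v s))].

Definition piecewise_smooth g (a b : R) : Prop :=
  exists2 s : seq R, itv_partition a b s &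
    forall i, (i < size s)%N -> smooth_arc g (nth b (a :: s) i) (nth b s i).

(* v is a one-sided derivative at s of g restricted to [a, b]. *)
Definition tangent g (a b s : R) (v : R[i]) : Prop :=
  (s < b /\ (g (s + h) - g s) / h%:C @[h --> 0^'+] --> v) \/
  (a < s /\ (g (s + h) - g s) / h%:C @[h --> 0^'-] --> v).

(* The coincidence g a = g b of a closed curve is not a self-intersection.
   The last inequality says that u and v are linearly independent over R. *)
Definition transversal_crossings g (a b : R) : Prop :=
  forall s t, a <= s -> s < t -> t <= b -> ~ (s = a /\ t = b) -> g s = g t ->
    forall u v, tangent g a b s u -> tangent g a b t v ->
      Re u * Im v - Im u * Re v != 0.

Record curve := Curve {
  cstart : R;
  cend : R;
  cpath :> R -> R[i];
  curve_lt : cstart < cend;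
  curve_continuous : {within `[cstart, cend], continuous cpath};
  curve_piecewise_smooth : piecewise_smooth cpath cstart cend;
  curve_transversal : transversal_crossings cpath cstart cend }.

Implicit Types gamma : curve.

Definition closed_curve gamma : Prop := gamma (cstart gamma) = gamma (cend gamma).

Definition curve_image gamma : set R[i] := gamma @` `[cstart gamma, cend gamma].

Definition avoids gamma (X : set (CP1 R)) : Prop :=
  forall z, curve_image gamma z -> ~ X (Some z).

(* Meaningful off the finitely many breakpoints, hence almost everywhere. *)
Definition velocity g (s : R) : R[i] :=
  derive1 (Re \o g) s +i* derive1 (Im \o g) s.

Definition Cintegral (a b : R) (f : R -> R[i]) : R[i] :=
  (\int[lebesgue_measure]_(s in `[a, b]) Re (f s))%R +i*
  (\int[lebesgue_measure]_(s in `[a, b]) Im (f s))%R.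

Definition line_integral gamma (f : R[i] -> R[i]) : R[i] :=
  Cintegral (cstart gamma) (cend gamma)
    (fun s => f (gamma s) * velocity gamma s).

Definition twopii : R[i] := 0 +i* (2 * pi).

Definition winding gamma (x : CP1 R) : R[i] :=
  if x is Some z then twopii^-1 * line_integral gamma (fun w => (w - z)^-1)
  else 0.

Definition on_one_side gamma (X : set (CP1 R)) : Prop :=
  [/\ closed_curve gamma, avoids gamma X &
      forall x y, X x -> X y -> winding gamma x = winding gamma y].

Definition outside gamma (X : set (CP1 R)) : Prop :=
  [/\ closed_curve gamma, avoids gamma X & forall x, X x -> winding gamma x = 0].

Definition U_infty (P : ratfun R) gamma : set (CP1 R) :=
  connected_component
    (~` [set reval P (Some z) | z in curve_image gamma]) None.

(* At infinity the integrand vanishes identically. *)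
Definition I_infty (q P : ratfun R) gamma (t : CP1 R) : R[i] :=
  if t is Some t' then
    twopii^-1 * line_integral gamma (fun z => rval q z / (rval P z - t'))
  else 0.

End Curves.

(* Main.v *)
Require Import Defs.
From mathcomp Require Import all_boot all_order all_algebra.
From mathcomp Require Import all_classical all_reals all_analysis.
From mathcomp Require Import complex.
From mathcomp Require Import measurable_realfun.
From mathcomp Require Import ring lra zify.

(* Write J(F) for the integral of F along gamma.  If B is a polynomial, then
   B(t) J(q/(P - t)) = A(t) + J(q B(P)/(P - t)) with A a polynomial.  If all the
   moments J(q B(P) P^k) are zero, then so are all J(q B(P)/(P - t)^k) for t in
   the component of infinity: expanding 1/(P - t), the set of such t contains a
   neighbourhood of infinity, and it is open and closed off P(gamma).  Hence
   J(q/(P - t)) = A(t)/B(t) there.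

   The moments vanish by partial fractions as soon as all the finite poles of
   the integrand have the same winding number w and either w = 0 or the
   integrand is O(1/z^2) at infinity.  For part (2) take B = 1.  For part (1),
   B is the product of the t - P(x), over the poles x of q which are not poles of
   P, and, when P is regular at infinity, of a high power of t - P(oo); if P has a
   pole at infinity, then w = 0.  A B of least degree has no zero in the component
   of infinity, so A/B has no pole there. *)

Set Implicit Arguments.
Unset Strict Implicit.
Unset Printing Implicit Defensive.

Import Order.TTheory GRing.Theory Num.Theory.
Import numFieldNormedType.Exports.

Local Open Scope classical_set_scope.
Local Open Scope ring_scope.
Local Open Scope complex_scope.
Local Open Scope quotient_scope.

(** * Piecewise fundamental theorem of calculus *)

Section RealIntegral.
Variable R : realType.
Local Notation mu := (@lebesgue_measure R).
Implicit Types (a b c d x : R) (f g h G : R -> R).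

(** The integrand [h] is tied to the continuous [g] only on the open interval, because [velocity]
    may take any value at a break point of the curve. *)
Definition ftc_piece h G c d :=
  exists2 g, {within `[c, d], continuous g} &
    forall x, x \in `]c, d[ -> h x = g x /\ is_derive x 1 G (g x).

Lemma within_segmentS a b c d (T : topologicalType) (f : R -> T) :
  a <= c -> d <= b ->
  {within `[a, b], continuous f} -> {within `[c, d], continuous f}.
Proof.
move=> ac db; apply: continuous_subspaceW => x /=.
by rewrite !in_itv/= => /andP[cx xd]; rewrite (le_trans ac)//= (le_trans xd).
Qed.

Lemma integrable_setU (A B : set R) f : measurable A -> measurable B ->
  mu.-integrable A (EFin \o f) -> mu.-integrable B (EFin \o f) ->
  mu.-integrable (A `|` B) (EFin \o f).
Proof.
move=> mA mB iA iB.
have mBA : measurable (B `\` A) by exact: measurableD.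
have iBA : mu.-integrable (B `\` A) (EFin \o f).
  by apply: integrableS iB => //; exact: subDsetl.
apply/integrable_mkcond; first exact: measurableU.
move: iA iBA => /integrable_mkcond => /(_ mA) iA /integrable_mkcond => /(_ mBA) iBA.
apply: eq_integrable (integrableD measurableT iA iBA) => // x _.
rewrite /= !patchE in_setU in_setD /=.
by case: (x \in A); case: (x \in B) => /=; rewrite ?adde0 ?add0e.
Qed.

(** The end points, where [h] is arbitrary, are split off as null sets. *)
Lemma integrable_segment c d h g : c < d -> {within `[c, d], continuous g} ->
  {in `]c, d[, h =1 g} -> mu.-integrable `[c, d] (EFin \o h).
Proof.
move=> cd cg hg.
have ig : mu.-integrable `[c, d] (EFin \o g).
  by apply: continuous_compact_integrable => //; exact: segment_compact.
have i1 (x : R) : mu.-integrable [set x] (EFin \o h).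
  apply: null_set_integrable => //; first exact: measurable_fun_set1.
  exact: lebesgue_measure_set1.
have -> : `[c, d]%classic = [set c] `|` (`]c, d[ `|` [set d]) :> set R.
  by rewrite setUitv1 ?bnd_simp// setU1itv ?bnd_simp ?ltW.
apply: integrable_setU => //; first exact: measurableU.
apply: integrable_setU => //.
apply: (@eq_integrable _ _ _ mu `]c, d[%classic _ (EFin \o g)) => //.
  by move=> x; rewrite inE/= => xcd; rewrite /= hg.
by apply: integrableS ig => //; exact: subset_itv_oo_cc.
Qed.

Lemma ftc_segment h G c d : c < d -> ftc_piece h G c d ->
  {within `[c, d], continuous G} ->
  mu.-integrable `[c, d] (EFin \o h) /\
  (\int[mu]_(x in `[c, d]) h x)%R = G d - G c.
Proof.
move=> cd [g cg hg] cG.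
have hgE : {in `]c, d[, h =1 g} by move=> x /hg[].
have ih := integrable_segment cd cg hgE; split => //.
have sub : `]c, d[%classic `<=` `[c, d]%classic by exact: subset_itv_oo_cc.
have ig : mu.-integrable `[c, d] (EFin \o g) by exact: (integrable_segment cd cg).
(* The integral passes to the open interval, where [h] can be replaced by [g], and then back to the
   closed one. *)
rewrite /Rintegral integral_itv_bndoo; last first.
  by apply: (measurable_int mu); exact: integrableS ih.
rewrite (_ : (\int[mu]_(x in `]c, d[) (h x)%:E =
   \int[mu]_(x in `]c, d[) (g x)%:E)%E); last first.
  by apply: eq_integral => x; rewrite inE/= => /hgE ->.
rewrite -(@integral_itv_bndoo R c d (EFin \o g) true false); last first.
  by apply: (measurable_int mu); exact: integrableS ig.
have [_ Gc Gd] := (continuous_within_itvP G cd).1 cG.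
rewrite (@continuous_FTC2 _ g G)//.
  by split => // x /hg[_ []].
by move=> x /hg[_ dG]; rewrite derive1E derive_val.
Qed.

Lemma ftc_partition h G b (s : seq R) a : itv_partition a b s ->
  (forall i, (i < size s)%N -> ftc_piece h G (nth b (a :: s) i) (nth b s i)) ->
  {within `[a, b], continuous G} -> a < b ->
  mu.-integrable `[a, b] (EFin \o h) /\
  (\int[mu]_(x in `[a, b]) h x)%R = G b - G a.
Proof.
elim: s a => [|x s IH] a.
  by move=> /itv_partition_nil ->; rewrite ltxx.
move=> abs pc cG ab; have xbs := itv_partition_cons abs.
have ax : a < x by case: abs => /andP[].
have xb := itv_partition_le xbs.
have p0 : ftc_piece h G a x := pc 0 isT.
have [i1 e1] := ftc_segment ax p0 (within_segmentS (lexx _) xb cG).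
case: (ltgtP x b) xb => // [xb _|xb _]; last by rewrite -xb.
have [i2 e2] := IH x xbs (fun i => pc i.+1)
  (within_segmentS (ltW ax) (lexx _) cG) xb.
have mU : `[a, b]%classic = `[a, x] `|` `]x, b] :> set R.
  by rewrite -itv_bndbnd_setU// bnd_simp// ltW.
have i2' : mu.-integrable `]x, b] (EFin \o h).
  by apply: integrableS i2 => //; exact: subset_itv_oc_cc.
have ii : mu.-integrable (`[a, x] `|` `]x, b]) (EFin \o h).
  exact: integrable_setU.
rewrite mU; split => //.
rewrite Rintegral_setU//; last first.
  apply/disj_setPS => y [] /=; rewrite !in_itv/= => /andP[_ yx] /andP[xy _].
  by have := lt_le_trans xy yx; rewrite ltxx.
rewrite Rintegral_itv_obnd_cbnd// e1 e2; ring.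
Qed.

End RealIntegral.

(** * Complex-valued functions of a real variable *)

Section ComplexModulus.
Variable R : realType.
Local Notation Re := (@complex.Re R).
Local Notation Im := (@complex.Im R).
Local Notation modulus := (@Normc.normc R).
Implicit Types z w : R[i].

Lemma normr_modulus z : `|z| = (modulus z)%:C. Proof. by []. Qed.

Lemma modulus_ge0 z : 0 <= modulus z.
Proof. by rewrite -lecR -normr_modulus normr_ge0. Qed.

Lemma modulus_eq0 z : (modulus z == 0) = (z == 0).
Proof. by apply/eqP/eqP => [/Normc.eq0_normc|->]; rewrite ?Normc.normc0. Qed.

Lemma modulusX z n : modulus (z ^+ n) = modulus z ^+ n.
Proof.
by elim: n => [|n IH]; rewrite ?expr0 ?Normc.normc1// !exprS Normc.normcM IH.
Qed.

Lemma modulus_distC z w : modulus (z - w) = modulus (w - z).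
Proof. by rewrite -(opprB w z); exact: normcN. Qed.

Lemma modulus_triangle z w x : modulus (z - w) <= modulus (z - x) + modulus (x - w).
Proof. by rewrite -(subrKA x); exact: le_normcD. Qed.

Lemma normr_Re_le z : `|Re z| <= modulus z.
Proof. by rewrite -lecR -normr_modulus normc_ge_Re. Qed.

Lemma normr_Im_le z : `|Im z| <= modulus z.
Proof.
case: z => x y /=; rewrite -sqrtr_sqr ler_wsqrtr//.
by rewrite lerDr sqr_ge0.
Qed.

Lemma modulus_le z : modulus z <= `|Re z| + `|Im z|.
Proof.
case: z => x y /=; rewrite -[leRHS]ger0_norm ?addr_ge0// -sqrtr_sqr ler_wsqrtr//.
rewrite sqrrD !real_normK ?num_real//.
by rewrite -addrA lerD2l lerDr mulrn_wge0// mulr_ge0.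
Qed.

Lemma Re_mul z w : Re (z * w) = Re z * Re w - Im z * Im w.
Proof. by case: z => ? ?; case: w. Qed.

Lemma Im_mul z w : Im (z * w) = Re z * Im w + Im z * Re w.
Proof. by case: z => ? ?; case: w. Qed.

Lemma Re_add z w : Re (z + w) = Re z + Re w.
Proof. by case: z => ? ?; case: w. Qed.

Lemma Im_add z w : Im (z + w) = Im z + Im w.
Proof. by case: z => ? ?; case: w. Qed.

Lemma Re_inv z : Re z^-1 = Re z / (Re z ^+ 2 + Im z ^+ 2).
Proof. by case: z. Qed.

Lemma Im_inv z : Im z^-1 = - Im z / (Re z ^+ 2 + Im z ^+ 2).
Proof. by case: z => x y /=; rewrite mulNr. Qed.

Lemma sqr_modulus_gt0 z : z != 0 -> Re z ^+ 2 + Im z ^+ 2 != 0.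
Proof.
case: z => x y; apply: contraNneq => /eqP /=.
by rewrite paddr_eq0 ?sqr_ge0// !sqrf_eq0 => /andP[/eqP-> /eqP->].
Qed.

Lemma ball_modulus z w (e : R) : ball z e%:C w <-> modulus (z - w) < e.
Proof. by rewrite -ltcR -normr_modulus. Qed.

End ComplexModulus.

Section ContinuousOnSegment.
Variables (R : realType) (a b : R).
Local Notation Re := (@complex.Re R).
Local Notation Im := (@complex.Im R).
Local Notation modulus := (@Normc.normc R).
Implicit Types (F G : R -> R[i]).

(** Continuity is recorded on the two coordinates because integrals, derivatives and extreme values
    are all taken for real functions. *)
Definition ccont F := {within `[a, b], continuous (Re \o F)} /\
                      {within `[a, b], continuous (Im \o F)}.

(** Both coordinate functions are 1-Lipschitz for the modulus. *)
Lemma ccont_within F : {within `[a, b], continuous F} -> ccont F.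
Proof.
have H (r : R[i] -> R) : continuous r ->
  {within `[a, b], continuous F} -> {within `[a, b], continuous (r \o F)}.
  by move=> cr cF x; exact: (continuous_comp (cF x) (cr _)).
have C (r : R[i] -> R) : (forall z w, `|r z - r w| <= modulus (z - w)) ->
    continuous r.
  move=> lip z; have FF : Filter (nbhs (z : R[i])) by exact: nbhs_filter.
  apply/(@cvgrPdist_lt _ _ _ (nbhs (z : R[i])) FF) => e e0.
  have B : nbhs (z : R[i]) (ball z e%:C) by apply: nbhsx_ballx; rewrite ltcR.
  by apply: filterS B => w /ball_modulus; exact: le_lt_trans.
move=> cF; split; apply: H => //; apply: C => -[x1 y1] [x2 y2].
  exact: (normr_Re_le ((x1 +i* y1) - (x2 +i* y2))).
exact: (normr_Im_le ((x1 +i* y1) - (x2 +i* y2))).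
Qed.

Lemma ccont_cst (c : R[i]) : ccont (fun=> c).
Proof. by split=> x; exact: cvg_cst. Qed.

Lemma ccontD F G : ccont F -> ccont G -> ccont (fun s => F s + G s).
Proof.
move=> [F1 F2] [G1 G2]; split.
  rewrite (_ : Re \o _ = (Re \o F) \+ (Re \o G)); last first.
    by apply/funext => s /=; rewrite Re_add.
  by move=> x; apply: cvgD; [exact: F1 | exact: G1].
rewrite (_ : Im \o _ = (Im \o F) \+ (Im \o G)); last first.
  by apply/funext => s /=; rewrite Im_add.
by move=> x; apply: cvgD; [exact: F2 | exact: G2].
Qed.

Lemma ccontM F G : ccont F -> ccont G -> ccont (fun s => F s * G s).
Proof.
move=> [F1 F2] [G1 G2]; split.
  rewrite (_ : Re \o _ = fun s =>
    (Re \o F) s * (Re \o G) s - (Im \o F) s * (Im \o G) s); last first.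
    by apply/funext => s /=; rewrite Re_mul.
  by move=> x; apply: cvgB; apply: cvgM; [exact: F1|exact: G1|exact: F2|exact: G2].
rewrite (_ : Im \o _ = fun s =>
  (Re \o F) s * (Im \o G) s + (Im \o F) s * (Re \o G) s); last first.
  by apply/funext => s /=; rewrite Im_mul.
by move=> x; apply: cvgD; apply: cvgM; [exact: F1|exact: G2|exact: F2|exact: G1].
Qed.

Lemma ccontX F n : ccont F -> ccont (fun s => F s ^+ n).
Proof.
move=> cF; elim: n => [|n IH]; first exact: ccont_cst.
by under eq_fun do rewrite exprS; exact: ccontM.
Qed.

Lemma ccontB F G : ccont F -> ccont G -> ccont (fun s => F s - G s).
Proof.
move=> cF cG; under eq_fun do rewrite -mulN1r.
by apply: ccontD => //; apply: ccontM => //; exact: ccont_cst.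
Qed.

Lemma ccontV F : (forall s, s \in `[a, b] -> F s != 0) -> ccont F ->
  ccont (fun s => (F s)^-1).
Proof.
move=> F0 [F1 F2].
have FN : {within `[a, b], continuous
    (fun s => ((Re \o F) s ^+ 2 + (Im \o F) s ^+ 2)^-1)}.
  apply/subspace_continuousP => x xab; apply: cvgV => /=.
    by apply: sqr_modulus_gt0; exact: F0.
  move/subspace_continuousP: F1 => /(_ x xab) F1.
  move/subspace_continuousP: F2 => /(_ x xab) F2.
  by apply: cvgD; rewrite expr2; under eq_fun do rewrite expr2; exact: cvgM.
split.
  rewrite (_ : Re \o _ = fun s =>
    (Re \o F) s * ((Re \o F) s ^+ 2 + (Im \o F) s ^+ 2)^-1); last first.
    by apply/funext => s /=; rewrite Re_inv.
  by move=> x; apply: cvgM; [exact: F1|exact: FN].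
rewrite (_ : Im \o _ = fun s =>
  - (Im \o F) s * ((Re \o F) s ^+ 2 + (Im \o F) s ^+ 2)^-1); last first.
  by apply/funext => s /=; rewrite Im_inv.
by move=> x; apply: cvgM; [apply: cvgN; exact: F2|exact: FN].
Qed.

Lemma ccont_horner (p : {poly R[i]}) F : ccont F -> ccont (fun s => p.[F s]).
Proof.
move=> cF; elim/poly_ind: p => [|p c IH].
  by under eq_fun do rewrite horner0; exact: ccont_cst.
under eq_fun do rewrite hornerMXaddC.
by apply: ccontD; [exact: ccontM | exact: ccont_cst].
Qed.

Lemma ccont_modulus F : ccont F ->
  {within `[a, b], continuous (fun s => modulus (F s))}.
Proof.
move=> [F1 F2].
rewrite (_ : (fun s => modulus (F s)) =
   fun s => Num.sqrt ((Re \o F) s * (Re \o F) s + (Im \o F) s * (Im \o F) s)); last first.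
  by apply/funext => s /=; case: (F s) => ? ? /=; rewrite !expr2.
move=> x; apply: continuous_comp; last exact: sqrt_continuous.
by apply: cvgD; apply: cvgM; [exact: F1|exact: F1|exact: F2|exact: F2].
Qed.

Lemma ccont_bounded F : a <= b -> ccont F ->
  exists2 M, 0 < M & forall s, s \in `[a, b] -> modulus (F s) <= M.
Proof.
move=> ab /ccont_modulus/(EVT_max ab)[c cab cmax].
exists (modulus (F c) + 1); first by rewrite ltr_pwDr// modulus_ge0.
by move=> s /cmax h; rewrite (le_trans h)// lerDl.
Qed.

Lemma ccont_away F : a <= b -> ccont F -> (forall s, s \in `[a, b] -> F s != 0) ->
  exists2 m, 0 < m & forall s, s \in `[a, b] -> m <= modulus (F s).
Proof.
move=> ab /ccont_modulus/(EVT_min ab)[c cab cmin] F0.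
exists (modulus (F c)) => //.
by rewrite lt_def modulus_ge0 modulus_eq0 F0.
Qed.

End ContinuousOnSegment.

Section ComplexDerivative.
Variable R : realType.
Local Notation Re := (@complex.Re R).
Local Notation Im := (@complex.Im R).
Implicit Types (F G : R -> R[i]) (s : R) (v w z : R[i]).

Definition is_cderive s F v :=
  is_derive s 1 (Re \o F) (Re v) /\ is_derive s 1 (Im \o F) (Im v).

Lemma is_cderive_velocity s F v : is_cderive s F v -> velocity F s = v.
Proof.
by case: v => x y [dx dy]; rewrite /velocity !derive1E !derive_val.
Qed.

Lemma is_cderive_cst s z : is_cderive s (fun=> z) 0.
Proof. by split; exact: is_derive_cst. Qed.

Lemma is_cderiveD s F G v w : is_cderive s F v -> is_cderive s G w ->
  is_cderive s (fun x => F x + G x) (v + w).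
Proof.
move=> [F1 F2] [G1 G2]; split.
  rewrite Re_add (_ : Re \o _ = (Re \o F) + (Re \o G)); first exact: is_deriveD.
  by apply/funext => x /=; rewrite Re_add.
rewrite Im_add (_ : Im \o _ = (Im \o F) + (Im \o G)); first exact: is_deriveD.
by apply/funext => x /=; rewrite Im_add.
Qed.

Lemma is_cderiveM s F G v w : is_cderive s F v -> is_cderive s G w ->
  is_cderive s (fun x => F x * G x) (v * G s + F s * w).
Proof.
move=> [F1 F2] [G1 G2]; split.
  rewrite (_ : Re \o _ = (Re \o F) * (Re \o G) - (Im \o F) * (Im \o G)).
    by apply: is_derive_eq; rewrite !Re_add !Re_mul /GRing.scale /=; ring.
  by apply/funext => x /=; rewrite Re_mul.
rewrite (_ : Im \o _ = (Re \o F) * (Im \o G) + (Im \o F) * (Re \o G)).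
  by apply: is_derive_eq; rewrite !Im_add !Im_mul /GRing.scale /=; ring.
by apply/funext => x /=; rewrite Im_mul.
Qed.

Lemma is_cderiveX s F v n : is_cderive s F v ->
  is_cderive s (fun x => F x ^+ n.+1) (n.+1%:R * F s ^+ n * v).
Proof.
move=> dF; elim: n => [|n IH].
  by rewrite expr0 mulr1 mul1r; under eq_fun do rewrite expr1.
under eq_fun do rewrite exprS.
rewrite (_ : _ * v = v * F s ^+ n.+1 + F s * (n.+1%:R * F s ^+ n * v)); first exact: is_cderiveM.
by rewrite -(addn1 n.+1) natrD exprS; ring.
Qed.

Lemma is_deriveV_real (f : R -> R) s df : f s != 0 -> is_derive s 1 f df ->
  is_derive s 1 (fun x => (f x)^-1) (- (f s) ^- 2 * df).
Proof.
move=> fs0 [df1 df2]; apply: DeriveDef; first exact: derivableV.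
by rewrite deriveV// df2.
Qed.

Lemma is_cderiveV s F v : F s != 0 -> is_cderive s F v ->
  is_cderive s (fun x => (F x)^-1) (- (F s)^-1 ^+ 2 * v).
Proof.
move=> Fs0 [F1 F2].
(* [N] is the squared modulus of [F], the common denominator of the two coordinates of the
   inverse. *)
pose N := (Re \o F) * (Re \o F) + (Im \o F) * (Im \o F).
have Ns0 : N s != 0 by have := sqr_modulus_gt0 Fs0; rewrite !expr2.
have dN : is_derive s 1 N (2 * (Re (F s) * Re v + Im (F s) * Im v)).
  by apply: is_derive_eq; rewrite /GRing.scale /=; ring.
have dV := is_deriveV_real Ns0 dN.
have NE : N s = Re (F s) * Re (F s) + Im (F s) * Im (F s) by [].
split.
  rewrite (_ : Re \o _ = (Re \o F) * (fun x => (N x)^-1)); last first.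
    by apply/funext => x /=; rewrite Re_inv !expr2.
  apply: is_derive_eq; rewrite NE in Ns0 *; move: Ns0; rewrite /GRing.scale /=.
  case: (F s) => x y; case: v {F1 F2 dN dV} => p q /= Ns0.
  by rewrite !expr2; field.
rewrite (_ : Im \o _ = - ((Im \o F) * (fun x => (N x)^-1))); last first.
  by apply/funext => x /=; rewrite Im_inv !expr2 mulNr.
apply: is_derive_eq; rewrite NE in Ns0 *; move: Ns0; rewrite /GRing.scale /=.
case: (F s) => x y; case: v {F1 F2 dN dV} => p q /= Ns0.
by rewrite !expr2; field.
Qed.
End ComplexDerivative.

(** * Integrals along a curve *)

(** A continuous function is bounded and measurable on the compact segment, and such a factor
    preserves integrability. *)
Lemma integrable_continuousM (R : realType) (a b : R) (f h : R -> R) : a <= b ->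
  {within `[a, b], continuous h} ->
  (@lebesgue_measure R).-integrable `[a, b] (EFin \o f) ->
  (@lebesgue_measure R).-integrable `[a, b] (EFin \o (fun x => h x * f x)).
Proof.
move=> ab ch fi.
rewrite (_ : EFin \o _ = ((EFin \o h) \* (EFin \o f))%E)//.
apply: integrableMr => //.
  exact: subspace_continuous_measurable_fun.
have [M _ hM] := @EVT_max R (fun x => `|h x|) a b ab (fun x =>
  continuous_comp (ch x) (@norm_continuous _ _ _)).
exists `|h M|; split; first exact: num_real.
move=> x xM y yab /=; rewrite (le_trans _ (ltW xM))//.
exact: hM.
Qed.

Section LineIntegral.
Variables (R : realType) (gamma : curve R).
Local Notation Re := (@complex.Re R).
Local Notation Im := (@complex.Im R).
Local Notation modulus := (@Normc.normc R).
Local Notation mu := (@lebesgue_measure R).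
Local Notation a := (cstart gamma).
Local Notation b := (cend gamma).
Implicit Types (F G H : R -> R[i]) (c z : R[i]).

Local Notation cc := (ccont a b).

(* F is a function of the parameter of gamma, not of the point of the plane. *)
Definition pint F : R[i] := Cintegral a b (fun s => F s * velocity gamma s).

Lemma ccont_curve : cc gamma.
Proof. exact/ccont_within/curve_continuous. Qed.

(** The fundamental theorem along [gamma]. The chain rule for [G] is asked only where [gamma] has a
    derivative, which covers the inside of each smooth arc; continuity of [G] bridges the break
    points. *)
Lemma pint_ftc_int G H : cc G -> cc H ->
  (forall s v, s \in `]a, b[ -> is_cderive s gamma v -> is_cderive s G (H s * v)) ->
  [/\ mu.-integrable `[a, b] (EFin \o (fun s => Re (H s * velocity gamma s))),
      mu.-integrable `[a, b] (EFin \o (fun s => Im (H s * velocity gamma s))) &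
      pint H = G b - G a].
Proof.
move=> [G1 G2] cH dG.
have [s abs arcs] := curve_piecewise_smooth gamma.
have piece i : (i < size s)%N -> let c := nth b (a :: s) i in let d := nth b s i in
    ftc_piece (fun s => Re (H s * velocity gamma s)) (Re \o G) c d /\
    ftc_piece (fun s => Im (H s * velocity gamma s)) (Im \o G) c d.
  move=> si c d.
  have ac : a <= c by exact: (itv_partition_nth_ge (m := i) (ltnW si) abs).
  have db : d <= b by exact: (itv_partition_nth_le (m := i.+1) si abs).
  have sub x : x \in `]c, d[ -> x \in `]a, b[.
    rewrite !in_itv/= => /andP[cx xd].
    by rewrite (le_lt_trans ac)//= (lt_le_trans xd).
  have [v [cv _ dv]] := arcs i si.
  have cHv : ccont c d (fun s => H s * v s).
    apply: ccontM; last exact: ccont_within.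
    by case: cH => H1 H2; split; apply: within_segmentS ac db _.
  case: cHv => Hv1 Hv2.
  split; [exists (fun s => Re (H s * v s)) => //|exists (fun s => Im (H s * v s)) => //].
    by move=> x xcd; rewrite (is_cderive_velocity (dv x xcd)); split => //;
      case: (dG x (v x) (sub x xcd) (dv x xcd)).
  by move=> x xcd; rewrite (is_cderive_velocity (dv x xcd)); split => //;
    case: (dG x (v x) (sub x xcd) (dv x xcd)).
have ab := curve_lt gamma.
have [i1 e1] := ftc_partition abs (fun i si => (piece i si).1) G1 ab.
have [i2 e2] := ftc_partition abs (fun i si => (piece i si).2) G2 ab.
split => //; rewrite /pint /Cintegral e1 e2 /=.
by case: (G a) => ? ?; case: (G b).
Qed.

(** This is the integrability half of [pint_ftc_int] for [G = gamma] and [H = 1]. *)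
Lemma velocity_integrable :
  mu.-integrable `[a, b] (EFin \o (Re \o velocity gamma)) /\
  mu.-integrable `[a, b] (EFin \o (Im \o velocity gamma)).
Proof.
have [|i1 i2 _] := @pint_ftc_int gamma (fun=> 1) ccont_curve (ccont_cst _ _ _).
  by move=> s v _; rewrite mul1r.
have E (r : R[i] -> R) : (fun s => r (1 * velocity gamma s)) = r \o velocity gamma.
  by apply/funext => s; rewrite /= mul1r.
by rewrite !E in i1 i2.
Qed.

Lemma pint_integrable F : cc F ->
  mu.-integrable `[a, b] (EFin \o (fun s => Re (F s * velocity gamma s))) /\
  mu.-integrable `[a, b] (EFin \o (fun s => Im (F s * velocity gamma s))).
Proof.
move=> [F1 F2]; have [v1 v2] := velocity_integrable.
have ab := ltW (curve_lt gamma).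
have [i11 i12] := (integrable_continuousM ab F1 v1, integrable_continuousM ab F1 v2).
have [i21 i22] := (integrable_continuousM ab F2 v1, integrable_continuousM ab F2 v2).
split.
  apply: eq_integrable (integrableB _ i11 i22) => //.
  by move=> x _; rewrite /= -EFinB Re_mul.
apply: eq_integrable (integrableD _ i12 i21) => //.
by move=> x _; rewrite /= -EFinD Im_mul.
Qed.

Lemma eq_pint F G : {in `[a, b], F =1 G} -> pint F = pint G.
Proof.
move=> FG; rewrite /pint /Cintegral; congr (_ +i* _);
  by apply: eq_Rintegral => s; rewrite inE/= => /FG ->.
Qed.

Lemma pintD F G : cc F -> cc G -> pint (fun s => F s + G s) = pint F + pint G.
Proof.
move=> /pint_integrable[F1 F2] /pint_integrable[G1 G2].
rewrite /pint /Cintegral -[RHS]/((_ + _) +i* (_ + _)) -!RintegralD//.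
congr (_ +i* _); apply: eq_Rintegral => s _; rewrite mulrDl.
  by rewrite Re_add.
by rewrite Im_add.
Qed.

Lemma pintZ c F : cc F -> pint (fun s => c * F s) = c * pint F.
Proof.
case: c => x y cF; have [F1 F2] := pint_integrable cF.
rewrite /pint /Cintegral -[RHS]/((_ - _) +i* (_ + _)) -!RintegralZl//.
have iZ (r : R) f : mu.-integrable `[a, b] (EFin \o f) ->
    mu.-integrable `[a, b] (EFin \o (fun s => r * f s)).
  by move=> fi; apply: eq_integrable (integrableZl _ r fi).
rewrite -RintegralB//; [|exact: iZ|exact: iZ].
rewrite -RintegralD//; [|exact: iZ|exact: iZ].
congr (_ +i* _); apply: eq_Rintegral => s _; rewrite -mulrA.
  by rewrite Re_mul.
by rewrite Im_mul.
Qed.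

Lemma pint_bound : exists2 K, 0 <= K & forall F M, cc F ->
  (forall s, s \in `[a, b] -> modulus (F s) <= M) -> modulus (pint F) <= M * K.
Proof.
have [v1 v2] := velocity_integrable.
pose V s := `|Re (velocity gamma s)| + `|Im (velocity gamma s)|.
have iV : mu.-integrable `[a, b] (EFin \o V).
  apply: eq_integrable (integrableD _ (integrable_norm v1) (integrable_norm v2)) => //.
(* [V] dominates the modulus of the velocity; the factor 2 comes from bounding the real and the
   imaginary part of the integral separately. *)
exists (2 * (\int[mu]_(s in `[a, b]) V s)%R).
  by rewrite mulr_ge0// Rintegral_ge0// => s _; rewrite /V addr_ge0.
move=> F M cF FM; have [F1 F2] := pint_integrable cF.
have part (r : R[i] -> R) : (forall z, `|r z| <= modulus z) ->
    mu.-integrable `[a, b] (EFin \o (fun s => r (F s * velocity gamma s))) ->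
    `|(\int[mu]_(s in `[a, b]) r (F s * velocity gamma s))%R| <=
    M * (\int[mu]_(s in `[a, b]) V s)%R.
  move=> rz ir; apply: (le_trans (le_normr_Rintegral _ ir)) => //.
  rewrite -RintegralZl//; apply: le_Rintegral => //.
  - exact: integrable_norm ir.
  - by apply: eq_integrable (integrableZl _ M iV) => //.
  - move=> s sab; apply: (le_trans (rz _)); rewrite Normc.normcM.
    apply: ler_pM; [exact: modulus_ge0|exact: modulus_ge0|exact: FM|].
    exact: modulus_le.
rewrite (le_trans (modulus_le _))//= mulrCA mulrDl mul1r lerD// part//.
  exact: normr_Re_le.
exact: normr_Im_le.
Qed.

End LineIntegral.

(** * Rational functions on a closed curve *)

Section ClosedCurve.
Variables (R : realType) (gamma : curve R).
Hypothesis gamma_closed : closed_curve gamma.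
Local Notation a := (cstart gamma).
Local Notation b := (cend gamma).
Local Notation cc := (ccont a b).
Local Notation pint := (pint gamma).
Implicit Types (c p w : R[i]) (s : seq R[i]).

Definition off_curve p := forall t, t \in `[a, b] -> gamma t != p.

Lemma ccont_subC p : cc (fun t => gamma t - p).
Proof. by apply: ccontB; [exact: ccont_curve|exact: ccont_cst]. Qed.

Lemma ccont_subV p : off_curve p -> cc (fun t => (gamma t - p)^-1).
Proof.
by move=> op; apply: ccontV; [move=> t /op; rewrite subr_eq0|exact: ccont_subC].
Qed.

Lemma pint0 : pint (fun=> 0) = 0.
Proof.
have := pintZ 0 (ccont_cst _ _ 0 : cc _).
by rewrite !mul0r.
Qed.

(** Along [gamma], [F ^+ n.+1] is a primitive of [n.+1] times the integrand, and it takes the same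
    value at both ends. *)
Lemma pint_pow F n (H : R -> R[i]) : cc F -> F a = F b -> cc H ->
  (forall t v, t \in `]a, b[ -> is_cderive t gamma v -> is_cderive t F (H t * v)) ->
  pint (fun t => F t ^+ n * H t) = 0.
Proof.
move=> cF Fab cH dF; have n0 : n.+1%:R != 0 :> R[i] by rewrite pnatr_eq0.
apply: (mulfI n0); rewrite mulr0 -pintZ; last by apply: ccontM => //; exact: ccontX.
have [|||_ _ ->] := @pint_ftc_int _ gamma (fun t => F t ^+ n.+1)
   (fun t => n.+1%:R * (F t ^+ n * H t)).
- exact: ccontX.
- by apply: ccontM; [exact: ccont_cst|apply: ccontM => //; exact: ccontX].
- move=> t v tab dg; rewrite (_ : _ * v = n.+1%:R * F t ^+ n * (H t * v)); last by ring.
  exact/is_cderiveX/dF.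
- by rewrite Fab subrr.
Qed.

Lemma pint_horner (N : {poly R[i]}) : pint (fun t => N.[gamma t]) = 0.
Proof.
have pow n : pint (fun t => gamma t ^+ n) = 0.
  rewrite -[RHS](@pint_pow gamma n (fun=> 1)) //.
  - by apply: eq_pint => t _; rewrite mulr1.
  - exact: ccont_curve.
  - exact: ccont_cst.
  - by move=> t v _; rewrite mul1r.
(* The extra power of [gamma] absorbs the factor ['X] in the induction on [N]. *)
suff H n : pint (fun t => gamma t ^+ n * N.[gamma t]) = 0.
  by rewrite -[RHS](H 0%N); apply: eq_pint => t _; rewrite mul1r.
elim/poly_ind: N n => [|N c IH] n.
  by rewrite -[RHS]pint0; apply: eq_pint => t _; rewrite horner0 mulr0.
rewrite (_ : pint _ = pint (fun t => gamma t ^+ n.+1 * N.[gamma t] + c * gamma t ^+ n)).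
  rewrite pintD ?IH ?pintZ ?pow ?mulr0 ?addr0//.
  - exact/ccontX/ccont_curve.
  - by apply: ccontM; [apply: ccontX|apply: ccont_horner]; exact: ccont_curve.
  - by apply: ccontM; [exact: ccont_cst|apply: ccontX; exact: ccont_curve].
by apply: eq_pint => t _; rewrite hornerMXaddC exprS; ring.
Qed.

(** With [F = 1/(gamma - p)] the derivative of [F] is [- F ^+ 2] times the velocity, so each power
    from the second on is of the form treated by [pint_pow]. *)
Lemma pint_invX p n : off_curve p -> pint (fun t => (gamma t - p)^-1 ^+ n.+2) = 0.
Proof.
move=> op; pose F t := (gamma t - p)^-1; have cF : cc F by exact: ccont_subV.
have c2 : cc (fun t => F t ^+ n.+2) by exact: ccontX.
apply: (mulfI (x := -1)); first by rewrite oppr_eq0 oner_eq0.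
rewrite mulr0 -pintZ// -[RHS](@pint_pow F n (fun t => - F t ^+ 2)) //.
- by apply: eq_pint => t _; rewrite mulN1r mulrN -exprD addn2.
- by rewrite /F gamma_closed.
- have -> : (fun t => - F t ^+ 2) = (fun t => -1 * F t ^+ 2).
    by apply/funext => t; rewrite mulN1r.
  by apply: ccontM; [exact: ccont_cst|exact: ccontX].
- move=> t v tab dg; rewrite /F; apply: is_cderiveV.
    by rewrite subr_eq0 op//; exact: subset_itv_oo_cc tab.
  by rewrite -[v]addr0; apply: is_cderiveD => //; exact: is_cderive_cst.
Qed.

Definition linear_prod s (z : R[i]) := \prod_(p <- s) (z - p).

Lemma linear_prod_neq0 s t : (forall p, p \in s -> off_curve p) ->
  t \in `[a, b] -> linear_prod s (gamma t) != 0.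
Proof.
move=> os tab; rewrite /linear_prod prodf_seq_neq0; apply/allP => p ps /=.
by rewrite subr_eq0 os.
Qed.

Lemma ccont_linear_prodV s : (forall p, p \in s -> off_curve p) ->
  cc (fun t => (linear_prod s (gamma t))^-1).
Proof.
move=> os; apply: ccontV => [t tab|]; first exact: linear_prod_neq0.
elim: s {os} => [|p s IH].
  by under eq_fun do rewrite /linear_prod big_nil; exact: ccont_cst.
under eq_fun do rewrite /linear_prod big_cons.
by apply: ccontM; first exact: ccont_subC.
Qed.

(* Two distinct roots p and q are separated by
   1/((z - p)(z - q)) = (1/(z - p) - 1/(z - q))/(p - q). *)
Lemma pint_linear_prodV w s :
    (forall p, p \in s -> off_curve p /\ pint (fun t => (gamma t - p)^-1) = w) ->
    (0 < size s)%N -> (1 < size s)%N \/ w = 0 ->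
  pint (fun t => (linear_prod s (gamma t))^-1) = 0.
Proof.
have [n] := ubnP (size s); elim: n s => // n IH [//|p s] sn os _ s1.
have oo q : q \in p :: s -> off_curve q by case/os.
have [/all_pred1P sE|/allPn[q qs /= qp]] := boolP (all (pred1 p) s).
  have -> : pint (fun t => (linear_prod (p :: s) (gamma t))^-1) =
      pint (fun t => (gamma t - p)^-1 ^+ (size s).+1).
    apply: eq_pint => t _; rewrite exprVn; congr (_^-1).
    rewrite /linear_prod big_cons exprS; congr (_ * _).
    by rewrite sE big_nseq size_nseq iter_mulr_1.
  case: (size s) (s1 : (0 < size s)%N \/ w = 0) => [[//|w0]|m _].
    by case: (os p (mem_head _ _)) => _; rewrite w0.
  by apply: pint_invX; apply: oo; rewrite mem_head.
pose r := rem q s.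
have perm : perm_eq s (q :: r) by exact: perm_to_rem.
have pq0 : p - q != 0 by rewrite subr_eq0 eq_sym.
have memr x : x \in r -> x \in p :: s by move=> /mem_rem; rewrite inE orbC => ->.
have rs : ((size r).+1 < n)%N by move: sn; rewrite /= (perm_size perm) /= ltnS.
have or x : x \in [:: p, q & r] -> off_curve x.
  rewrite !inE => /or3P[/eqP->|/eqP->|/memr /oo//].
    by apply: oo; rewrite mem_head.
  by apply: oo; rewrite inE qs orbT.
have ccp : cc (fun t => (linear_prod (p :: r) (gamma t))^-1).
  by apply: ccont_linear_prodV => x; rewrite inE => xr; apply: or;
     rewrite !inE; case/orP: xr => ->; rewrite ?orbT.
have ccq : cc (fun t => (linear_prod (q :: r) (gamma t))^-1).
  by apply: ccont_linear_prodV => x; rewrite inE => xr; apply: or;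
     rewrite !inE; case/orP: xr => ->; rewrite ?orbT.
transitivity (pint (fun t => (p - q)^-1 * ((linear_prod (p :: r) (gamma t))^-1 +
   -1 * (linear_prod (q :: r) (gamma t))^-1))).
  apply: eq_pint => t tab; rewrite /linear_prod !big_cons (perm_big _ perm) /= !big_cons.
  have D0 : linear_prod r (gamma t) != 0.
    by apply: linear_prod_neq0 => // x xr; apply: or; rewrite !inE xr !orbT.
  have p0 : gamma t - p != 0 by rewrite subr_eq0 or// mem_head.
  have q0 : gamma t - q != 0 by rewrite subr_eq0 or// !inE eqxx orbT.
  rewrite -/(linear_prod r (gamma t)); field.
  by rewrite p0 q0 D0 pq0.
rewrite pintZ ?pintD ?pintZ//; last first.
- by apply: ccontD => //; apply: ccontM => //; exact: ccont_cst.
- by apply: ccontM => //; exact: ccont_cst.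
(* The two shorter products have the same integral, whether one factor is left or more, so their
   difference cancels. *)
have val x : x = p \/ x = q -> pint (fun t => (linear_prod (x :: r) (gamma t))^-1)
    = if r is [::] then w else 0.
  move=> xpq; have ox : off_curve x /\ pint (fun t => (gamma t - x)^-1) = w.
    by case: xpq => ->; apply: os; rewrite ?mem_head// inE qs orbT.
  case rE : r => [|y r'].
    by case: ox => _ <-; apply: eq_pint => t _; rewrite /linear_prod big_seq1.
  rewrite -rE; apply: IH => //=; last by left; rewrite rE.
  by move=> z; rewrite inE => /predU1P[->//|/memr/os].
by rewrite val ?val; [rewrite mulN1r subrr mulr0|right|left].
Qed.

(** Dividing [N] by ['X - p%:P] leaves a fraction with one factor less and a constant over the full
    product. Since a size is a degree plus one, [size N < size s] means decay like 1/z^2 at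
    infinity; the division lowers both sides by one. *)
Lemma pint_rational w (N : {poly R[i]}) s :
    (forall p, p \in s -> off_curve p /\ pint (fun t => (gamma t - p)^-1) = w) ->
    (size N < size s)%N \/ w = 0 ->
  pint (fun t => N.[gamma t] / linear_prod s (gamma t)) = 0.
Proof.
elim: s N => [|p s IH] N os Ns.
  rewrite -[RHS](pint_horner N); apply: eq_pint => t _.
  by rewrite /linear_prod big_nil divr1.
have oo q : q \in p :: s -> off_curve q by case/os.
have [->|N0] := eqVneq N 0.
  by rewrite -[RHS]pint0; apply: eq_pint => t _; rewrite horner0 mul0r.
pose M := N %/ ('X - p%:P).
have NE : N = M * ('X - p%:P) + (N.[p])%:P by rewrite -modp_XsubC -divp_eq.
have cM : cc (fun t => M.[gamma t] / linear_prod s (gamma t)).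
  apply: ccontM; first exact/ccont_horner/ccont_curve.
  by apply: ccont_linear_prodV => q qs; apply: oo; rewrite inE qs orbT.
have cV : cc (fun t => (linear_prod (p :: s) (gamma t))^-1).
  exact: ccont_linear_prodV.
transitivity (pint (fun t => M.[gamma t] / linear_prod s (gamma t) +
    N.[p] * (linear_prod (p :: s) (gamma t))^-1)).
  apply: eq_pint => t tab; rewrite {1}NE !hornerE /linear_prod big_cons.
  have D0 : linear_prod s (gamma t) != 0.
    by apply: linear_prod_neq0 => // x xr; apply: oo; rewrite !inE xr !orbT.
  have p0 : gamma t - p != 0 by rewrite subr_eq0 oo// mem_head.
  by rewrite -/(linear_prod s (gamma t)); field; rewrite p0 D0.
have SM : size M = (size N).-1.
  by rewrite /M size_divp ?polyXsubC_eq0// size_XsubC subn1.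
have Npos : (0 < size N)%N by rewrite lt0n size_poly_eq0.
rewrite pintD ?pintZ//; last by apply: ccontM => //; exact: ccont_cst.
rewrite IH; last 2 first.
- by move=> q qs; apply: os; rewrite inE qs orbT.
- by case: Ns => [/= Ns|->]; [left; rewrite SM -ltnS prednK|right].
rewrite (pint_linear_prodV os) ?mulr0 ?addr0//.
by case: Ns => [/= Ns|->]; [left; exact: leq_ltn_trans Ns|right].
Qed.

End ClosedCurve.

(** * Propagation of vanishing integrals *)

Section ComplexPlaneTopology.
Variable R : realType.
Local Notation Re := (@complex.Re R).
Local Notation Im := (@complex.Im R).
Local Notation modulus := (@Normc.normc R).

Lemma nbhs_modulus (z : R[i]) (e : R) : 0 < e ->
  nbhs z [set w | modulus (z - w) < e].
Proof.
move=> e0; have B : nbhs z (ball z e%:C) by apply: nbhsx_ballx; rewrite ltcR.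
by apply: filterS B => w /ball_modulus.
Qed.

(** Squares are the compact sets whose complements serve as neighbourhoods of infinity; they are
    continuous images of products of segments. *)
Definition square (K : R) : set R[i] := [set z | `|Re z| <= K /\ `|Im z| <= K].

Lemma compact_square K : compact (square K).
Proof.
pose f (xy : R * R) : R[i] := xy.1 +i* xy.2.
have -> : square K = f @` (`[- K, K] `*` `[- K, K]).
  apply/seteqP; split => [[x y] [/= xK yK]|_ [[x y] [/= xK yK] <-]].
    by exists (x, y) => //; rewrite /= !in_itv/= -!ler_norml.
  by rewrite !in_itv/= -!ler_norml in xK yK.
apply: continuous_compact; last first.
  by apply: compact_setX; exact: segment_compact.
apply: continuous_subspaceT => -[x y] A /nbhs_ballP[e /= e0 eA].
have r0 : 0 < Re e by move: e0; rewrite ltcE => /andP[].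
have eE : e = (Re e)%:C.
  by move: e0; rewrite ltcE => /andP[/eqP]; case: (e) => ? ? /= ->.
apply/nbhs_ballP; exists (Re e / 2); first by rewrite /= divr_gt0.
move=> [x' y'] [/= xx' yy']; apply: eA; rewrite eE; apply/ball_modulus.
apply: (le_lt_trans (modulus_le _)); rewrite (splitr (Re e)) ltrD//.
Qed.

Lemma closed_square K : closed (square K).
Proof.
apply: compact_closed; last exact: compact_square.
exact: (@norm_hausdorff _ (R[i])^o).
Qed.

End ComplexPlaneTopology.

Section Vanishing.
Variables (R : realType) (gamma : curve R).
Local Notation a := (cstart gamma).
Local Notation b := (cend gamma).
Local Notation cc := (ccont a b).
Local Notation pint := (pint gamma).
Local Notation modulus := (@Normc.normc R).

(* S_j, the integral of Q A^j B^(m+1), satisfies S_j = k S_(j+1) by induction on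
   m, hence S_j = k^n S_(j+n) = O(2^-n). *)
Lemma pint_transfer (Q A B : R -> R[i]) (c0 c1 k : R[i]) :
  cc Q -> cc A -> cc B ->
  (forall t, t \in `[a, b] -> B t = c0 + c1 * A t + k * A t * B t) ->
  (forall t, t \in `[a, b] -> modulus (k * A t) <= 2^-1) ->
  (forall j, pint (fun t => Q t * A t ^+ j) = 0) ->
  forall m j, pint (fun t => Q t * A t ^+ j * B t ^+ m) = 0.
Proof.
move=> cQ cA cB BE kA QA; elim=> [|m IH] j.
  by rewrite -[RHS](QA j); apply: eq_pint => t _; rewrite mulr1.
pose S j := pint (fun t => Q t * A t ^+ j * B t ^+ m.+1).
have cS i n : cc (fun t => Q t * A t ^+ i * B t ^+ n).
  by apply: ccontM; [apply: ccontM => //|]; exact: ccontX.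
have cZ (c : R[i]) F : cc F -> cc (fun t => c * F t).
  by move=> cF; apply: ccontM => //; exact: ccont_cst.
(* One factor [B] is expanded by [BE]; the two terms in [B ^+ m] vanish by [IH]. *)
have Sk i : S i = k * S i.+1.
  transitivity (pint (fun t => c0 * (Q t * A t ^+ i * B t ^+ m) +
      (c1 * (Q t * A t ^+ i.+1 * B t ^+ m) + k * (Q t * A t ^+ i.+1 * B t ^+ m.+1)))).
    apply: eq_pint => t /BE /(congr1 (fun x => Q t * A t ^+ i * B t ^+ m * x)) tE.
    transitivity (Q t * A t ^+ i * B t ^+ m * B t); first by rewrite exprS; ring.
    by rewrite {}tE !exprS; ring.
  rewrite !pintD ?pintZ ?IH ?mulr0 ?add0r//; try exact: cZ.
  by apply: ccontD; exact: cZ.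
have Sn n : S j = pint (fun t => (k * A t) ^+ n * (Q t * A t ^+ j * B t ^+ m.+1)).
  transitivity (k ^+ n * S (j + n)%N).
    elim: n => [|n ->]; first by rewrite mul1r addn0.
    by rewrite Sk exprSr mulrA addnS.
  rewrite /S -pintZ//; apply: eq_pint => t _; rewrite exprD exprMn; ring.
have [K K0 bound] := pint_bound gamma.
have ab := ltW (curve_lt gamma).
have [M M0 hM] := ccont_bounded ab (cS j m.+1).
have small n : modulus (S j) * 2 ^+ n <= M * K.
  rewrite -ler_pdivlMr ?exprn_gt0//.
  rewrite (Sn n) (_ : M * K / _ = 2^-1 ^+ n * M * K); last by rewrite exprVn; ring.
  apply: bound => [|t tab].
    by apply: ccontM => //; exact/ccontX/cZ.
  rewrite Normc.normcM modulusX ler_pM ?exprn_ge0 ?modulus_ge0 ?hM//.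
  by rewrite lerXn2r ?nnegrE ?modulus_ge0 ?invr_ge0// kA.
apply/eqP; rewrite -modulus_eq0 -/(S j) eq_le modulus_ge0 andbT leNgt; apply/negP => S0.
(* Such an [n] contradicts [small n], because [n < 2 ^ n]. *)
have [n] : exists n : nat, M * K / modulus (S j) < n%:R.
  by exists (Num.bound (M * K / modulus (S j)));
    rewrite archi_boundP// divr_ge0 ?mulr_ge0 ?(ltW M0)// ltW.
rewrite ltr_pdivrMr// => /(le_lt_trans (small n)).
rewrite mulrC ltr_pM2r// -natrX ltr_nat ltnNge => /negP; apply.
by rewrite ltnW// ltn_expl.
Qed.

Variables (Q p : R -> R[i]).
Hypotheses (cQ : cc Q) (cp : cc p).

Definition off_image (z : R[i]) := forall t, t \in `[a, b] -> p t != z.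

(** All powers are included: from the first on they give, up to sign-free factorials, the
    derivatives at [z] of the integral of [Q/(p - z)], so their vanishing can spread to nearby
    points. *)
Definition vanishing (z : R[i]) := off_image z /\
  forall k, pint (fun t => Q t * (p t - z)^-1 ^+ k) = 0.

Lemma ccont_resolvent z : off_image z -> cc (fun t => (p t - z)^-1).
Proof.
move=> oz; apply: ccontV => [t /oz|]; first by rewrite subr_eq0.
by apply: ccontB => //; exact: ccont_cst.
Qed.

(** The resolvent identity 1/(p - w) = 1/(p - z) + (w - z)/((p - z)(p - w)) is fed to
    [pint_transfer]. The radius depends only on the distance from [z] to the image of [p]. *)
Lemma vanishing_near (m : R) z w : 0 < m ->
  (forall t, t \in `[a, b] -> m <= modulus (p t - z)) ->
  2 * modulus (w - z) <= m -> vanishing z -> vanishing w.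
Proof.
move=> m0 mz wz [oz vz].
have ow : off_image w.
  move=> t tab; apply/eqP => pw; have := mz t tab; rewrite pw => mw.
  by move: (le_trans wz mw) (lt_le_trans m0 mw); set u := modulus _; lra.
split=> [|k]; first exact: ow.
have cz := ccont_resolvent oz; have cw := ccont_resolvent ow.
have step := @pint_transfer Q _ _ 0 1 (w - z) cQ cz cw _ _ vz k 0%N.
rewrite -[RHS]step.
- by apply: eq_pint => t _; rewrite mulr1.
- move=> t tab; have := oz t tab; have := ow t tab.
  rewrite -subr_eq0 => pw; rewrite -subr_eq0 => pz; field.
  by rewrite pw pz.
- move=> t tab; rewrite Normc.normcM Normc.normcV.
  have pm := mz t tab; rewrite ler_pdivrMr ?(lt_le_trans m0)//.
  by rewrite mulrC ler_pdivlMr// mulrC (le_trans wz).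
Qed.

(** Here [pint_transfer] moves from powers of [p] to powers of the resolvent, through 1/(p - z) = -
    1/z + (p/z)/(p - z) with p/z of modulus below 1/2. *)
Lemma vanishing_large (M : R) z : 0 < M ->
  (forall t, t \in `[a, b] -> modulus (p t) <= M) ->
  (forall k, pint (fun t => Q t * p t ^+ k) = 0) ->
  2 * M < modulus z -> vanishing z.
Proof.
move=> M0 pM v Mz.
have z0 : z != 0 by rewrite -modulus_eq0 gt_eqF// (lt_trans _ Mz)// mulr_gt0.
have oz : off_image z.
  move=> t tab; apply/eqP => pz; have := pM t tab; rewrite pz leNgt (lt_trans _ Mz)//.
  by rewrite ltr_pMl// ltrDl.
split=> [|k]; first exact: oz.
have cz := ccont_resolvent oz.
have step := @pint_transfer Q _ _ (- z^-1) 0 z^-1 cQ cp cz _ _ v k 0%N.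
rewrite -[RHS]step.
- by apply: eq_pint => t _; rewrite mulr1.
- move=> t tab; have := oz t tab.
  by rewrite -subr_eq0 => pz; field; rewrite pz z0.
- move=> t tab; rewrite Normc.normcM Normc.normcV mulrC.
  rewrite ler_pdivrMr ?(lt_trans _ Mz) ?mulr_gt0//.
  rewrite mulrC ler_pdivlMr// mulrC (le_trans _ (ltW Mz))//.
  by rewrite ler_pM2l// pM.
Qed.

(** Adding infinity to the points where [vanishing] holds gives an open set [G], by the two
    preceding lemmas. Its trace on the connected set [C] is also closed, hence is all of [C]. *)
Lemma vanishing_component (X : set (CP1 R)) (z : R[i]) :
  (forall t, t \in `[a, b] -> X (Some (p t))) ->
  (forall k, pint (fun t => Q t * p t ^+ k) = 0) ->
  connected_component (~` X) None (Some z) -> vanishing z.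
Proof.
move=> pX moments [C [CN CX connC] Cz].
have ab := ltW (curve_lt gamma).
pose G : set (CP1 R) := [set x | if x is Some w then vanishing w else True].
have away w : off_image w -> exists2 m, 0 < m & forall t, t \in `[a, b] -> m <= modulus (p t - w).
  move=> ow; apply: ccont_away => //; last by move=> t /ow; rewrite subr_eq0.
  by apply: ccontB => //; exact: ccont_cst.
have openG : open G.
  rewrite openE => -[w vw|_].
    have [m m0 mw] := away w vw.1.
    have m20 : 0 < m / 2 by rewrite divr_gt0.
    apply: filterS (nbhs_modulus w m20) => w' /= ww'.
    apply: (vanishing_near m0 mw) vw.
    by rewrite modulus_distC mulrC -ler_pdivlMr// ltW.
  have [M M0 pM] := ccont_bounded ab cp.
  exists (square (2 * M)) => /=; first by split; [exact: compact_square|exact: closed_square].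
  move=> _ [[w nw <-]|->]; last exact: I.
  apply: (vanishing_large M0 pM moments).
  rewrite ltNge; apply/negP => wM; apply: nw; split; apply: le_trans wM.
    exact: normr_Re_le.
  exact: normr_Im_le.
have CG : C `&` G = C.
  apply: connC; first by exists None.
    by exists G.
  exists (closure G); first exact: closed_closure.
  apply/seteqP; split => [x [Cx Gx]|x [Cx cGx]]; first by split; [exact: Cx|exact: subset_closure].
  split; first exact: Cx.
  case: x Cx cGx => [w|_ _]; last exact: I.
  move=> Cw cGw.
  have ow : off_image w.
    by move=> t tab; apply/eqP => pw; apply: (CX _ Cw); rewrite -pw; exact: pX.
  have [m m0 mw] := away w ow.
  (* The limit point [w] lies at distance at least [m] from the image. A point [w'] of [G] within
     [m / 4] of [w] stays at distance at least [m / 2], and twice its distance to [w] is below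
     [m / 2], so [vanishing_near] leads back to [w]. *)
  have m40 : 0 < m / 4 by rewrite divr_gt0.
  have [y []] := cGw _ (one_point_compactification_some_nbhs _ _ (nbhs_modulus w m40)).
  move=> /[swap] -[w' /= ww' <-] vw'.
  apply: (vanishing_near (m := m / 2) _ _ _ vw').
  - by rewrite divr_gt0.
  - move=> t tab; have := mw t tab.
    have := modulus_triangle (p t) w w'; rewrite [modulus (w' - w)]modulus_distC => h1 h2.
    move: (le_trans h2 h1) ww' m0; set u := modulus _; set v := modulus _; lra.
  - move: ww' m0; set u := modulus _; lra.
by move: Cz; rewrite -CG => -[].
Qed.

End Vanishing.

(** * Cancellation of poles *)

Section RationalFunctions.
Variable R : realType.
Implicit Types (f : ratfun R) (N A B : {poly R[i]}).

Lemma repr_den_neq0 f : (repr f).2 != 0.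
Proof. exact: denom_ratioP. Qed.

Lemma coprime_rnum_rden f : coprimep (rnum f) (rden f).
Proof. by apply: coprimep_div_gcd; rewrite repr_den_neq0 orbT. Qed.

Lemma rnum_gcd f : (repr f).1 = rnum f * gcdp (repr f).1 (repr f).2.
Proof. by rewrite divpK// dvdp_gcdl. Qed.

Lemma rden_gcd f : (repr f).2 = rden f * gcdp (repr f).1 (repr f).2.
Proof. by rewrite divpK// dvdp_gcdr. Qed.

Lemma rden_neq0 f : rden f != 0.
Proof.
by apply: contraNneq (repr_den_neq0 f) => f0; rewrite rden_gcd f0 mul0r.
Qed.

(** The chosen representative of the class of [A / B] satisfies the cross-multiplied identity; its
    gcd then cancels. *)
Lemma exists_ratfun A B : B != 0 ->
  exists f : ratfun R, rnum f * B = A * rden f.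
Proof.
move=> B0; pose f : ratfun R := \pi_(ratfun R) (Ratio A B); exists f.
have := FracField.equivf_r (Ratio A B); rewrite !numden_Ratio//.
rewrite -/f [X in _ * X]rden_gcd [X in _ = _ * X]rnum_gcd => E.
have g0 : gcdp (repr f).1 (repr f).2 != 0.
  by rewrite gcdp_eq0 negb_and repr_den_neq0 orbT.
by apply: (mulIf g0); rewrite -[RHS]mulrA E; ring.
Qed.

Lemma poles_finite f z : root (rden f) z -> poles f (Some z).
Proof. by rewrite /poles /= => ->. Qed.

(** Roots are listed with multiplicity, so [monic_den] is [rden] without its leading coefficient,
    which is moved into [nnum]. *)
Definition roots_den f := sval (closed_field_poly_normal (rden f)).
Definition nnum f := (lead_coef (rden f))^-1 *: rnum f.
Definition monic_den f := \prod_(p <- roots_den f) ('X - p%:P).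

Lemma rdenE f : rden f = lead_coef (rden f) *: monic_den f.
Proof. by rewrite /monic_den /roots_den; case: closed_field_poly_normal. Qed.

Lemma lead_rden_neq0 f : lead_coef (rden f) != 0.
Proof. by rewrite lead_coef_eq0 rden_neq0. Qed.

Lemma monic_denE f z : (monic_den f).[z] = linear_prod (roots_den f) z.
Proof.
rewrite /monic_den /linear_prod horner_prod; apply: eq_bigr => p _.
by rewrite hornerXsubC.
Qed.

Lemma rvalE f z : rval f z = (nnum f).[z] / linear_prod (roots_den f) z.
Proof.
rewrite /rval {1}rdenE /nnum !hornerZ monic_denE invfM; ring.
Qed.

Lemma root_rdenE f z : root (rden f) z = (z \in roots_den f).
Proof. by rewrite rdenE rootZ ?lead_rden_neq0// root_prod_XsubC. Qed.

Lemma size_monic_den f : size (monic_den f) = (size (roots_den f)).+1.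
Proof. exact: size_prod_XsubC. Qed.

Lemma size_rden f : size (rden f) = (size (roots_den f)).+1.
Proof. by rewrite rdenE size_scale ?lead_rden_neq0// size_monic_den. Qed.

(* c is the value of f at infinity. *)
Lemma size_sub_value_infty f : (size (rnum f) <= size (rden f))%N ->
  exists c, (size (nnum f - c *: monic_den f)%R <= size (roots_den f))%N /\
            (size (nnum f) <= (size (roots_den f)).+1)%N.
Proof.
move=> nd; have sn : (size (nnum f) <= (size (roots_den f)).+1)%N.
  by rewrite -size_rden (leq_trans _ nd)// size_scale_leq.
exists (nnum f)`_(size (roots_den f)); split => //.
apply/leq_sizeP => j; rewrite leq_eqVlt => /predU1P[<-|jn].
  rewrite coefB (coefZ _ (monic_den f)).
  have /monicP : monic_den f \is monic by exact: monic_prod_XsubC.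
  by rewrite /lead_coef size_monic_den /= => ->; rewrite mulr1 subrr.
rewrite coefB (coefZ _ (monic_den f)) [(monic_den f)`_j]nth_default ?size_monic_den//.
by rewrite nth_default ?mulr0 ?subrr// (leq_trans sn).
Qed.

End RationalFunctions.

Section AlongCurve.
Variables (R : realType) (gamma : curve R).
Local Notation a := (cstart gamma).
Local Notation b := (cend gamma).
Local Notation cc := (ccont a b).
Local Notation pint := (pint gamma).
Implicit Types (f q P : ratfun R) (F G : R -> R[i]).

Lemma avoids_off_curve (X : set (CP1 R)) z :
  avoids gamma X -> X (Some z) -> off_curve gamma z.
Proof.
move=> av Xz t tab; apply/eqP => gz; apply: (av z) => //.
by exists t.
Qed.

(** The fraction need not be reduced: products then just concatenate the lists of poles, and the
    order at infinity is read off from sizes. *)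
Definition represents (S : {pred R[i]}) F (N : {poly R[i]}) s :=
  {subset s <= S} /\
  forall t, t \in `[a, b] -> F t = N.[gamma t] / linear_prod s (gamma t).

Lemma linear_prod_cat s1 s2 (z : R[i]) :
  linear_prod (s1 ++ s2) z = linear_prod s1 z * linear_prod s2 z.
Proof. exact: big_cat. Qed.

Lemma linear_prod_cons x s (z : R[i]) :
  linear_prod (x :: s) z = (z - x) * linear_prod s z.
Proof. exact: big_cons. Qed.

Lemma representsM S F G N1 N2 s1 s2 : represents S F N1 s1 -> represents S G N2 s2 ->
  represents S (fun t => F t * G t) (N1 * N2) (s1 ++ s2).
Proof.
move=> [sub1 e1] [sub2 e2]; split=> [x|t tab].
  by rewrite mem_cat => /orP[/sub1|/sub2].
by rewrite e1// e2// linear_prod_cat hornerM invfM; ring.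
Qed.

Lemma representsX S F N s k : represents S F N s ->
  represents S (fun t => F t ^+ k) (N ^+ k) (flatten (nseq k s)).
Proof.
move=> rF; elim: k => [|k IH].
  by split=> // t _; rewrite !expr0 hornerC /linear_prod big_nil divr1.
by rewrite /= !exprS; under eq_fun do rewrite exprS; exact: representsM.
Qed.

Lemma represents_rval f :
  represents (mem (roots_den f)) (fun t => rval f (gamma t)) (nnum f) (roots_den f).
Proof. by split=> // t _; exact: rvalE. Qed.

Lemma represents_sub (S S' : {pred R[i]}) F N s : {subset S <= S'} ->
  represents S F N s -> represents S' F N s.
Proof. by move=> SS [sub e]; split => // x /sub/SS. Qed.

Lemma ccont_rval f : avoids gamma (poles f) -> cc (fun t => rval f (gamma t)).
Proof.
move=> av; rewrite (_ : (fun _ => _) = fun t =>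
    (nnum f).[gamma t] * (linear_prod (roots_den f) (gamma t))^-1).
  apply: ccontM; first exact/ccont_horner/ccont_curve.
  apply: ccont_linear_prodV => p; rewrite -root_rdenE => /poles_finite.
  exact: avoids_off_curve.
by apply/funext => t; rewrite rvalE.
Qed.

Lemma twopii_neq0 : twopii R != 0.
Proof.
by rewrite /twopii eq_complex /= negb_and mulf_neq0 ?orbT// gt_eqF// pi_gt0.
Qed.

Lemma windingE z : pint (fun t => (gamma t - z)^-1) = twopii R * winding gamma (Some z).
Proof. by rewrite /winding mulrA mulfV ?twopii_neq0// mul1r. Qed.

(* Multiplying by the factor P - P(x) cancels a pole at x. *)
Lemma cancel_poles P (N0 : {poly R[i]}) (s0 : seq R[i]) :
  avoids gamma (poles P) -> (forall x, x \in s0 -> off_curve gamma x) ->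
  exists B, exists N, exists s, B != 0 /\
    represents (mem (roots_den P))
      (fun t => N0.[gamma t] / linear_prod s0 (gamma t) * B.[rval P (gamma t)]) N s.
Proof.
move=> avP os0; elim: s0 os0 => [|x s0 IH] os0.
  exists 1, N0, [::]; split; first exact: oner_neq0.
  by split=> // t _; rewrite hornerC mulr1.
have [y ys|B [N [s [B0 [sub rep]]]]] := IH.
  by apply: os0; rewrite inE ys orbT.
have x0 t : t \in `[a, b] -> gamma t - x != 0.
  by move=> tab; rewrite subr_eq0 os0// mem_head.
(* A pole of [P] may stay in the denominator; any other [x] has to be cancelled. *)
have [xP|xP] := boolP (x \in roots_den P).
  exists B, N, (x :: s); split=> //; split=> [y|t tab].
    by rewrite inE => /predU1P[->//|/sub].
  rewrite /linear_prod !big_cons !invfM.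
  by have := rep t tab; rewrite /linear_prod => E; rewrite -[RHS]mulrCA -E; ring.
have Lx0 : linear_prod (roots_den P) x != 0.
  by rewrite -monic_denE -rootE root_prod_XsubC.
have [n rE] : exists n : {poly R[i]},
    forall z, rval P z = n.[z] / linear_prod (roots_den P) z.
  by exists (nnum P); exact: rvalE.
(* Up to a nonzero constant, [D] is the numerator of P - P(x) over [monic_den P]; it vanishes at
   [x], and its cofactor [E] is what remains after the cancellation. *)
pose D := n * (linear_prod (roots_den P) x)%:P - n.[x] *: monic_den P.
have /factor_theorem[E DE] : root D x.
  by rewrite rootE /D !hornerE monic_denE mulrC subrr.
exists (B * ('X - (rval P x)%:P)).
exists (N * ((linear_prod (roots_den P) x)^-1 *: E)), (s ++ roots_den P).
split; first by rewrite mulf_neq0// polyXsubC_eq0.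
split=> [y|t tab]; first by rewrite mem_cat => /orP[/sub|].
have L0 : linear_prod (roots_den P) (gamma t) != 0.
  apply: (linear_prod_neq0 (gamma := gamma)) => // p; rewrite -root_rdenE => /poles_finite.
  exact: avoids_off_curve.
have PxE : rval P (gamma t) - rval P x = (linear_prod (roots_den P) x)^-1 * E.[gamma t]
     * (gamma t - x) / linear_prod (roots_den P) (gamma t).
  have := congr1 (horner^~ (gamma t)) DE; rewrite /D !hornerE monic_denE => DtE.
  rewrite -[_ * E.[_] * _]mulrA -DtE !rE; field.
  by rewrite Lx0 L0.
rewrite !hornerE PxE linear_prod_cat invfM.
transitivity (N0.[gamma t] / linear_prod s0 (gamma t) * B.[rval P (gamma t)] *
  ((linear_prod (roots_den P) x)^-1 * E.[gamma t] / linear_prod (roots_den P) (gamma t))).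
  rewrite linear_prod_cons invfM.
  by have := x0 t tab; set L := (linear_prod s0 _)^-1; move=> ? /=; field; rewrite L0 Lx0.
have := rep t tab => /= ->; ring.
Qed.

End AlongCurve.

(** * Moments and polynomial multipliers *)

Section Moments.
Variables (R : realType) (gamma : curve R).
Local Notation a := (cstart gamma).
Local Notation b := (cend gamma).
Local Notation cc := (ccont a b).
Local Notation pint := (pint gamma).
Implicit Types (P f : ratfun R) (A B : {poly R[i]}) (z : R[i]).

Definition moments_vanish (q p : R -> R[i]) B :=
  forall k, pint (fun t => q t * B.[p t] * p t ^+ k) = 0.

Section Multiplier.
Variables (q p : R -> R[i]).
Hypotheses (cq : cc q) (cp : cc p).

Lemma ccont_weight B : cc (fun t => q t * B.[p t]).
Proof. by apply: ccontM; last exact: ccont_horner. Qed.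

(* If z is a root of B = B1 (X - z), the first vanishing at z kills the zeroth
   moment of B1, and p B1 = B + z B1 propagates this to all its moments. *)
Lemma multiplier_without_roots (U : set R[i]) B :
  (forall B', moments_vanish q p B' -> forall z, U z ->
     vanishing gamma (fun t => q t * B'.[p t]) p z) ->
  B != 0 -> moments_vanish q p B ->
  exists B', [/\ B' != 0, moments_vanish q p B' & forall z, U z -> B'.[z] != 0].
Proof.
move=> van; have [n] := ubnP (size B); elim: n B => // n IH B sB B0 mB.
have [[z Uz /factor_theorem[B1 BE]]|noroot] := pselect (exists2 z, U z & root B z);
  last by exists B; split=> // z Uz; apply/negP => zB; apply: noroot; exists z.
have B10 : B1 != 0 by apply: contraNneq B0 => B10; rewrite BE B10 mul0r.
have cB1 k : cc (fun t => q t * B1.[p t] * p t ^+ k).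
  by apply: ccontM; [exact: ccont_weight|exact: ccontX].
apply: (IH B1) => //.
  by move: sB; rewrite BE size_Mmonic ?monicXsubC// size_XsubC addn2.
elim=> [|k IHk].
  have [oz vz] := van B mB z Uz.
  rewrite -[RHS](vz 1); apply: eq_pint => t tab.
  have : p t - z != 0 by rewrite subr_eq0 oz.
  by rewrite BE !hornerE => pz /=; field.
rewrite -[RHS](mB k).
transitivity (pint (fun t => q t * B.[p t] * p t ^+ k + z * (q t * B1.[p t] * p t ^+ k))).
  by apply: eq_pint => t _; rewrite BE !hornerE exprS /=; ring.
rewrite pintD ?pintZ ?IHk ?mulr0 ?addr0//.
- by apply: ccontM; [exact: ccont_weight|exact: ccontX].
- by apply: ccontM; first exact: ccont_cst.
Qed.

(* [A z] is the integral of [q (B z - B p) / (p - z)], a polynomial in [z]. *)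
Lemma divided_difference B : exists2 A : {poly R[i]}, (size A <= (size B).-1)%N &
  forall z, off_image gamma p z ->
    pint (fun t => q t * (p t - z)^-1) * B.[z] =
    A.[z] + pint (fun t => q t * B.[p t] * (p t - z)^-1).
Proof.
have cr B' z : off_image gamma p z -> cc (fun t => q t * B'.[p t] * (p t - z)^-1).
  by move=> oz; apply: ccontM; [exact: ccont_weight|exact: ccont_resolvent].
have cr1 z : off_image gamma p z -> cc (fun t => q t * (p t - z)^-1).
  by move=> oz; apply: ccontM => //; exact: ccont_resolvent.
have cZ (c : R[i]) F : cc F -> cc (fun t => c * F t).
  by move=> cF; apply: ccontM => //; exact: ccont_cst.
elim/poly_ind: B => [|B c [A sA AE]].
  exists 0; rewrite ?size_poly0// => z oz; rewrite !horner0 mulr0 add0r -[LHS](pint0 gamma).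
  by apply: eq_pint => t _; rewrite horner0 mulr0 mul0r.
have [->|B0] := eqVneq B 0.
  exists 0; rewrite ?size_poly0// => z oz.
  rewrite mul0r add0r horner0 add0r hornerC mulrC -pintZ; last exact: cr1.
  by apply: eq_pint => t _; rewrite hornerC; ring.
have sBc : size (B * 'X + c%:P) = (size B).+1 by rewrite size_MXaddC (negPf B0).
have sB0 : (0 < size B)%N by rewrite lt0n size_poly_eq0.
(* From z B(z) - p B(p) = z (B(z) - B(p)) - (p - z) B(p): dividing by p - z multiplies the previous
   [A] by z and subtracts the integral of [q B(p)]. *)
exists (A * 'X + (- pint (fun t => q t * B.[p t]))%:P).
  by rewrite sBc size_MXaddC /=; case: ifP => // _; rewrite -(prednK sB0) ltnS.
move=> z oz; rewrite !hornerMXaddC mulrDr mulrA AE//.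
transitivity (A.[z] * z + - pint (fun t => q t * B.[p t]) +
  (pint (fun t => q t * B.[p t]) + (z * pint (fun t => q t * B.[p t] * (p t - z)^-1)
   + c * pint (fun t => q t * (p t - z)^-1)))); first by ring.
congr (_ + _).
have c1 := cZ z _ (cr B z oz); have c2 := cZ c _ (cr1 z oz).
rewrite -(pintZ z (cr B z oz)) -(pintZ c (cr1 z oz)) -(pintD c1 c2).
rewrite -(pintD (ccont_weight B) (ccontD c1 c2)).
apply: eq_pint => t tab; rewrite hornerMXaddC.
have : p t - z != 0 by rewrite subr_eq0 oz.
by move=> pz; field.
Qed.

End Multiplier.

(** The case [N = 0] is listed apart because [size N < size s] fails for it when [s] is empty. *)
Lemma pint_represents (S : {pred R[i]}) F N s w :
  closed_curve gamma -> represents gamma S F N s ->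
  (forall x, x \in S -> off_curve gamma x /\ pint (fun t => (gamma t - x)^-1) = w) ->
  N = 0 \/ (size N < size s)%N \/ w = 0 -> pint F = 0.
Proof.
move=> cl [sub FE] Sw Ns.
transitivity (pint (fun t => N.[gamma t] / linear_prod s (gamma t))).
  by apply: eq_pint => t /FE.
case: Ns => [->|Ns].
  by rewrite -[RHS](pint0 gamma); apply: eq_pint => t _; rewrite horner0 mul0r.
by apply: (pint_rational cl (w := w)) => // x /sub/Sw.
Qed.

Lemma exists_multiplier P f w :
  closed_curve gamma -> avoids gamma (poles P) -> avoids gamma (poles f) ->
  (forall x, x \in roots_den P ->
     off_curve gamma x /\ pint (fun t => (gamma t - x)^-1) = w) ->
  (size (rnum P) <= size (rden P))%N \/ w = 0 ->
  exists2 B, B != 0 & moments_vanish (fun t => rval f (gamma t))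
     (fun t => rval P (gamma t)) B.
Proof.
move=> cl avP avf Pw Pinf.
have offf x : x \in roots_den f -> off_curve gamma x.
  by rewrite -root_rdenE => /poles_finite; exact: avoids_off_curve.
have [B [N [s [B0 rep]]]] := cancel_poles (nnum f) avP offf.
have repB : represents gamma (mem (roots_den P))
    (fun t => rval f (gamma t) * B.[rval P (gamma t)]) N s.
  case: rep => sub rep; split=> // t tab; have := rep t tab => /= <-.
  by rewrite rvalE.
have repX k := representsX k (represents_rval gamma P).
case: Pinf => [Pinf|w0]; last first.
  exists B => // k; apply: (pint_represents (w := w) cl (representsM repB (repX k))).
    by move=> x /Pw.
  by right; right.
have [c [sN1 sNP]] := size_sub_value_infty Pinf.
set N1 := nnum P - c *: monic_den P in sN1.
have rep1 : represents gamma (mem (roots_den P))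
    (fun t => rval P (gamma t) - c) N1 (roots_den P).
  split=> // t tab; have L0 : linear_prod (roots_den P) (gamma t) != 0.
    by apply: (linear_prod_neq0 (gamma := gamma)) => // x /Pw[].
  rewrite /N1 hornerD hornerN (hornerZ _ (monic_den P)) monic_denE rvalE; field.
  exact: L0.
(* Each factor P - c gains at least one order of vanishing at infinity, and powers of [P] stay
   bounded there. For nonzero [N], [M] exceeds its degree by two, which leaves at least a double
   zero. *)
pose M := (size N).+1.
exists (B * ('X - c%:P) ^+ M); first by rewrite mulf_neq0// expf_neq0// polyXsubC_eq0.
move=> k; have := representsM (representsM repB (representsX M rep1)) (repX k).
have -> : (fun t => rval f (gamma t) * B.[rval P (gamma t)] * (rval P (gamma t) - c) ^+ M
    * rval P (gamma t) ^+ k) =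
  (fun t => rval f (gamma t) * (B * ('X - c%:P) ^+ M).[rval P (gamma t)]
    * rval P (gamma t) ^+ k).
  by apply/funext => t; rewrite hornerM horner_exp hornerXsubC; ring.
move=> repk; apply: (pint_represents (w := w) cl repk); first by move=> x /Pw.
have [N10|N10] := eqVneq N1 0; first by left; rewrite N10 expr0n mulr0 mul0r.
right; left.
have size_flat m (s' : seq R[i]) : size (flatten (nseq m s')) = (m * size s')%N.
  by elim: m => //= m IH; rewrite size_cat IH.
rewrite size_cat [X in (X + _)%N]size_cat !size_flat.
have s10 : (0 < size N1)%N by rewrite lt0n size_poly_eq0.
have := size_polyMleq (N * N1 ^+ M) (nnum P ^+ k).
have := size_polyMleq N (N1 ^+ M).
have := size_poly_exp_leq N1 M; have := size_poly_exp_leq (nnum P) k.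
move: sN1 sNP s10; rewrite /M.
set x1 := size N1; set x2 := size (N1 ^+ _); set x3 := size (nnum P).
set x4 := size (nnum P ^+ k); set x5 := size (N * _); set x6 := size (_ * nnum P ^+ k).
set x := size N; set d := size (roots_den P); move=> h1 h2 h3 h4 h5 h6 h7.
(* The products of variables in the degree count are settled first: [h8] uses that the degree of
   [N1] is below [d], [h9] that the degree of [nnum P] is at most [d]. *)
have h8 : (x1.-1 * x.+1 + x.+1 <= d * x.+1)%N by nia.
have h9 : (x3.-1 * k <= d * k)%N by nia.
lia.
Qed.

End Moments.

(** * The function [I_infty] on the component of infinity *)

Section Main.
Variables (R : realType) (P : ratfun R) (gamma : curve R).
Hypothesis P_gamma : avoids gamma (poles P).
Local Notation a := (cstart gamma).
Local Notation b := (cend gamma).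
Local Notation pint := (pint gamma).
Local Notation p := (fun t => rval P (gamma t)).
Implicit Types (q f : ratfun R) (z : R[i]).

Lemma U_infty_vanishing Q z : ccont a b Q ->
  (forall k, pint (fun t => Q t * p t ^+ k) = 0) ->
  U_infty P gamma (Some z) -> vanishing gamma Q p z.
Proof.
move=> cQ mQ; apply: vanishing_component => //; first exact: ccont_rval.
move=> t tab; exists (gamma t); first by exists t.
rewrite /= ifF//; apply/negP => /poles_finite; apply: P_gamma.
by exists t.
Qed.

(** [w] is [twopii] times the common winding number. If infinity is itself a pole of [P], that
    number is the one assigned to infinity, namely 0. *)
Lemma winding_infty_regular : on_one_side gamma (poles P) ->
  exists2 w, forall x, x \in roots_den P ->
     off_curve gamma x /\ pint (fun t => (gamma t - x)^-1) = w &
  (size (rnum P) <= size (rden P))%N \/ w = 0.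
Proof.
move=> [cl _ eqw].
have off x : x \in roots_den P -> off_curve gamma x.
  by rewrite -root_rdenE => /poles_finite; exact: avoids_off_curve.
have [Pinf|Pinf] := leqP (size (rnum P)) (size (rden P)); last first.
  exists 0; last by right.
  move=> x xP; split; first exact: off.
  rewrite windingE (eqw (Some x) None) ?mulr0//.
    by apply: poles_finite; rewrite root_rdenE.
  by rewrite /poles /= Pinf.
case E : (roots_den P) => [|x0 s]; first by exists 0; [|right].
rewrite -E; exists (pint (fun t => (gamma t - x0)^-1)); last by left.
move=> x xP; split; first exact: off.
rewrite !windingE (eqw (Some x) (Some x0))//; apply: poles_finite; rewrite root_rdenE//.
by rewrite E mem_head.
Qed.

Lemma I_inftyE q z : I_infty q P gamma (Some z) =
  (twopii R)^-1 * pint (fun t => rval q (gamma t) * (p t - z)^-1).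
Proof. by []. Qed.

(** On [U_infty] the remainder in [divided_difference] is the first resolvent integral of a weight
    with vanishing moments, hence 0, and there [B] has no root to divide by. *)
Lemma I_infty_rational q : on_one_side gamma (poles P) -> avoids gamma (poles q) ->
  rational_on (U_infty P gamma) (I_infty q P gamma).
Proof.
move=> sideP avq; have [w Pw Pinf] := winding_infty_regular sideP.
have [cl _ _] := sideP.
have cq := ccont_rval avq; have cp := ccont_rval P_gamma.
have [B0 B00 mB0] := exists_multiplier cl P_gamma avq Pw Pinf.
have [B [Bneq0 mB BU]] := multiplier_without_roots
  (U := [set z | U_infty P gamma (Some z)]) cq cp
  (fun B' mB' z Uz => U_infty_vanishing (ccont_weight cq cp B') mB' Uz) B00 mB0.
have [A sA AE] := divided_difference cq cp B.
have [f fE] := exists_ratfun ((twopii R)^-1 *: A) Bneq0.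
exists f => -[z|] Uz.
  have [oz vz] := U_infty_vanishing (ccont_weight cq cp B) mB Uz.
  have Bz := BU z Uz.
  have IE : I_infty q P gamma (Some z) * B.[z] = ((twopii R)^-1 *: A).[z].
    by rewrite I_inftyE -mulrA (AE z oz) (vz 1%N) addr0 hornerZ.
  have := congr1 (horner^~ z) fE; rewrite /= !hornerM -IE.
  rewrite mulrAC => /(mulIf Bz) nE.
  (* By [nE] a root of the denominator at [z] would also be a root of the numerator, against
     coprimality. *)
  have dz : ~~ root (rden f) z.
    apply/negP => dz; have := coprime_rnum_rden f; rewrite coprimep_sym.
    move=> /coprimep_root/(_ dz); rewrite nE (eqP dz : (rden f).[z] = 0) mulr0.
    by rewrite eqxx.
  by rewrite /= (negPf dz) /rval nE mulfK.
(* At infinity [I_infty] is 0, and so must be the value of [f]: the strict inequality between the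
   sizes of [A] and [B] passes to [rnum f] and [rden f] through [fE]. *)
have snd : (size (rnum f) < size (rden f))%N.
  have d0 : (0 < size (rden f))%N by rewrite lt0n size_poly_eq0 rden_neq0.
  have [->|n0] := eqVneq (rnum f) 0; first by rewrite size_poly0.
  have B1 : (0 < size B)%N by rewrite lt0n size_poly_eq0.
  have := congr1 (size \o @polyseq _) fE; rewrite /= size_mul//.
  have := size_polyMleq ((twopii R)^-1 *: A) (rden f).
  have := size_scale_leq (twopii R)^-1 A.
  move: sA B1 d0; set x1 := size A; set x2 := size (_ *: A); set x3 := size (_ * rden f).
  set x4 := size (rnum f); set x5 := size B; set x6 := size (rden f); lia.
rewrite /= ltnNge (ltnW snd) /= nth_default ?mul0r//.
by rewrite -ltnS prednK// (leq_ltn_trans _ snd).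
Qed.

(** The finite poles of each [q * P ^+ k] are among those of [P] and [q], so the case [w = 0] of
    [pint_represents] kills every moment, with multiplier 1. *)
Lemma I_infty_zero q t : avoids gamma (poles q) ->
  outside gamma (poles P `|` poles q) -> U_infty P gamma t ->
  I_infty q P gamma t = 0.
Proof.
move=> avq [cl _ wind0]; case: t => [z Uz|//].
have cq := ccont_rval avq.
pose S : {pred R[i]} := [pred x | (x \in roots_den P) || (x \in roots_den q)].
have S0 x : x \in S -> off_curve gamma x /\ pint (fun t => (gamma t - x)^-1) = 0.
  move=> xS; have xpole : (poles P `|` poles q) (Some x).
    by case/orP: xS; rewrite -root_rdenE => /poles_finite; [left|right].
  split; last by rewrite windingE wind0 ?mulr0.
  by case: xpole; exact: avoids_off_curve.
have mq k : pint (fun t => rval q (gamma t) * p t ^+ k) = 0.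
  have rq := represents_sub (S' := S) _ (represents_rval gamma q).
  have rp := represents_sub (S' := S) _ (representsX k (represents_rval gamma P)).
  have rqp : represents gamma S (fun t => rval q (gamma t) * p t ^+ k)
    (nnum q * nnum P ^+ k) (roots_den q ++ flatten (nseq k (roots_den P))).
    apply: representsM.
      by apply: rq => x xq; rewrite inE xq orbT.
    by apply: rp => x xq; rewrite inE xq.
  by apply: (pint_represents cl rqp S0); right; right.
have [_ v] := U_infty_vanishing cq mq Uz.
by rewrite I_inftyE (v 1%N) mulr0.
Qed.

End Main.

Theorem corollary2p2 (R : realType) (P : ratfun R) (gamma : curve R)
    (P_nonconstant : nonconstant P) (P_gamma : avoids gamma (poles P)) :
  (on_one_side gamma (poles P) ->
     forall q : ratfun R, q <> 0 -> avoids gamma (poles q) ->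
       rational_on (U_infty P gamma) (I_infty q P gamma)) /\
  (forall q : ratfun R, q <> 0 -> avoids gamma (poles q) ->
     outside gamma (poles P `|` poles q) ->
     forall t, U_infty P gamma t -> I_infty q P gamma t = 0).
Proof.
split=> [side q _ avq|q _ avq out t]; first exact: I_infty_rational.
exact: I_infty_zero.
Qed.
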